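(* The Isaacs' conjecture holds for orthogonal $2$-layered Heisenberg groups over a finite fields of characteristic greater than $3$.
   Context: Let $\mathbb{F}=\mathbb{F}_q$ be a finite field of characteristic $p>3$. Let $\mathfrak{g}$ be $\mathfrak{so}_{2n+1}(\mathbb{F})$ (root system $\Phi=B_n$) or $\mathfrak{so}_{2n}(\mathbb{F})$ (root system $\Phi=D_n$), realized as the matrices $x$ with $\beta(u,xv)+\beta(xu,v)=0$, where $\beta(u,v)=u_0v_0+\sum_{i=1}^n(u_iv_{-i}+u_{-i}v_i)$ on $\mathbb{F}^{2n+1}$ with basis $e_1,\ldots,e_n,e_0,e_{-n},\ldots,e_{-1}$ (type $B_n$), respectively $\beta(u,v)=\sum_{i=1}^n(u_iv_{-i}+u_{-i}v_i)$ on $\mathbb{F}^{2n}$ with basis $e_1,\ldots,e_n,e_{-n},\ldots,e_{-1}$ (type $D_n$). Let $\mathfrak{n}$ be the algebra of strictly upper-triangular matrices in $\mathfrak{g}$, with basis of root vectors $e_\alpha$, $\alpha\in\Phi^+$, where $e_{\varepsilon_i}=\sqrt2(e_{0,i}-e_{-i,0})$, $e_{\varepsilon_i-\varepsilon_j}=e_{i,j}-e_{-j,-i}$, $e_{\varepsilon_i+\varepsilon_j}=e_{i,-j}-e_{j,-i}$ ($e_{i,j}$ the elementary matrices). Define $\mathrm{col}(\varepsilon_i\pm\varepsilon_j)=\mathrm{col}(\varepsilon_i)=i$ and the $j$th column $\mathcal{C}_j=\{\alpha\in\Phi^+\mid\mathrm{col}(\alpha)=j\}$. The orthogonal $2$-layered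 Heisenberg group is $\mathrm{Hei}_2(\Phi)=\exp\mathfrak{hei}_2(\Phi)$, where $\mathfrak{hei}_2(\Phi)=\langle e_\alpha,~\alpha\in\mathcal{C}_1\cup\mathcal{C}_2\rangle_{\mathbb{F}}$, for $\Phi=B_n$ or $D_n$. Isaacs' conjecture (for a finite unipotent group $U$) states that for every $e\geq0$, the number of irreducible complex characters of $U$ of degree $q^e$ is a polynomial in $v=q-1$ with nonnegative integer coefficients.
   Formalization: In type B the root vector of ε_i is taken as e_{i,0} − e_{0,−i}, because √2(e_{0,i} − e_{−i,0}) is not upper triangular in the given basis order and √2 may not exist in F_q; n ≥ 2 is assumed so that two columns exist. *)

(* Defs.v *)
From HB Require Import structures.
From mathcomp Require Import all_boot all_order all_algebra all_fingroup all_field all_character.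
Set Implicit Arguments. Unset Strict Implicit. Unset Printing Implicit Defensive.
Import GRing.Theory Num.Theory.
Local Open Scope ring_scope.

(* The two root systems considered: B_n (so_{2n+1}) and D_n (so_{2n}). *)
Inductive rtype := TypeB | TypeD.

Definition vdim (t : rtype) (n : nat) : nat :=
  match t with TypeB => n.*2.+1 | TypeD => n.*2 end.

(* Signed indices of the basis vectors e_i (i>0), e_0, e_{-i}. *)
Inductive sidx := Pos of nat | Zero | Neg of nat.

(* 0-based position of a basis vector in the ordered basis
   e_1,...,e_n,(e_0),e_{-n},...,e_{-1}. *)
Definition pos (t : rtype) (n : nat) (a : sidx) : nat :=
  match t, a with
  | TypeB, Pos i => i.-1
  | TypeB, Zero => n
  | TypeB, Neg i => n.*2.+1 - i
  | TypeD, Pos i => i.-1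
  | TypeD, Zero => 0 (* unused: no e_0 in type D *)
  | TypeD, Neg i => n.*2 - i
  end.

Section Heisenberg.
Variables (F : finFieldType) (t : rtype) (n : nat).

Notation d := (vdim t n).
Notation M := 'M[F]_(d.-1.+1).

Definition emx (a b : sidx) : M :=
  delta_mx (inord (pos t n a)) (inord (pos t n b)).

(* Root vectors e_alpha for alpha in C_1 u C_2 (rows i = 1, 2). *)
Definition hei2_rootvecs : seq M :=
  [seq emx (Pos i) (Pos j) - emx (Neg j) (Neg i)
     | i <- iota 1 (minn 2 n), j <- iota i.+1 (n - i)]       (* eps_i - eps_j *)
  ++ [seq emx (Pos i) (Neg j) - emx (Pos j) (Neg i)
     | i <- iota 1 (minn 2 n), j <- iota i.+1 (n - i)]       (* eps_i + eps_j *)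
  ++ (if t is TypeB then
        [seq emx (Pos i) Zero - emx Zero (Neg i) | i <- iota 1 (minn 2 n)]
      else [::]).                                           (* eps_i (type B) *)

Definition hei2_lie : {set M} :=
  [set \sum_(k < size hei2_rootvecs) c k *: hei2_rootvecs`_k
     | c : {ffun 'I_(size hei2_rootvecs) -> F}].

(* Exponential of a nilpotent matrix (truncated series). *)
Definition mexp (x : M) : M :=
  \sum_(k < d.-1.+1) (k`!%:R)^-1 *: x ^+ k.

Definition Hei2_set : {set {'GL_d[F]}} :=
  [set g : {'GL_d[F]} | [exists x in hei2_lie, GLval g == mexp x]].

Definition Hei2 : {group {'GL_d[F]}} := <<Hei2_set>>%G.

End Heisenberg.

(* Main.v *)
(* With e, f the first two basis vectors and e', f' the last two, Hei_2 is the set of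
   products S_e(w) S_f(v) of Eichler-Siegel transformations, w orthogonal to e, e' and
   v orthogonal to e, e', f, f' (the space W of such v has dimension m = d - 4).  As
   S_f(v) S_e(w) = S_e(S_f(v) w) S_f(v), it is a semidirect product, of order q^(2m+2).
   Put Z = {S_e(c f)}, U = {S_e(w) : w orthogonal to f}, A = {v = 0} and
   B = {w orthogonal to f}.  An irreducible character nontrivial on Z is induced from a
   linear character of the abelian group A, hence has degree q^m; one trivial on Z and
   not on U is induced from a linear character of B (abelian modulo Z), hence has degree
   q; and G/U is abelian.  Sums of squares of degrees then give (q-1)q, (q^m-1)q^(m-1) and
   q^(m+1) characters of degrees q^m, q and 1, which are nonnegative in v = q - 1. *)
Require Import Defs.
From HB Require Import structures.
From mathcomp Require Import all_boot all_order all_algebra all_fingroup all_solvable all_field all_character.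
From mathcomp Require Import ring zify.
Set Implicit Arguments. Unset Strict Implicit. Unset Printing Implicit Defensive.
Import GRing.Theory Num.Theory.
Local Open Scope ring_scope.

(** * Arithmetic of the sums of squares of degrees *)

Lemma irr_count_top q m x : (0 < q)%N ->
  (x * (q ^ m) ^ 2 + q ^ (m + m).+1 = q ^ (m + m).+2)%N -> x = (q * q.-1)%N.
Proof.
case: q => // q _; have p0 : (0 < q.+1 ^ (m + m))%N by rewrite expn_gt0.
rewrite -mulnn -expnD !expnS => E; apply/eqP; rewrite -(eqn_pmul2r p0).
by move: E => /=; set p := (q.+1 ^ _)%N => E; apply/eqP; nia.
Qed.

(** Solves the sum of squares for the family of degree q. At m = 0 the truncated [m.-1] is harmless:
    the factor [(q ^ m).-1] vanishes and the family is empty. *)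
Lemma irr_count_middle q m x : (0 < q)%N ->
  (x * q ^ 2 + q ^ m.+1 = q ^ (m + m).+1)%N -> x = (q ^ m.-1 * (q ^ m).-1)%N.
Proof.
case: q => // q _; have p0 : (0 < q.+1 ^ 2)%N by rewrite expn_gt0.
case: m => [|m] /=; first by rewrite add0n muln0; nia.
have qm0 : (0 < q.+1 ^ m.+1)%N by rewrite expn_gt0.
have -> : (m.+1 + m.+1).+1 = (2 + m + m.+1)%N by rewrite add2n !addSn.
(* Writing one factor q^m.+1 on the right as 1 + (q^m.+1 - 1) lets q^m.+2 cancel from both sides. *)
rewrite -[m.+2]/(2 + m)%N [(q.+1 ^ (_ + _ + _))%N]expnD -{1}(prednK qm0) mulnS addnC expnD.
move=> /addnI E; apply/eqP; rewrite -(eqn_pmul2r p0) E; apply/eqP.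
by rewrite -mulnA mulnC.
Qed.

(** * Degrees and numbers of irreducible characters along normal subgroups *)

Section IrrDegrees.
Local Open Scope group_scope.
Local Open Scope ring_scope.
Variables (gT : finGroupType) (G : {group gT}).
Implicit Types A K L : {group gT}.

(* A linear constituent lam of the restriction to A is moved by every g outside
   A, as otherwise lam would be trivial on L; so lam induces irreducibly. *)
Lemma irr1_index A K L (i : Iirr G) :
    A <| G -> K \subset A -> L <| G -> L \subset A -> (A^`(1))%g \subset K ->
    (forall g z, g \in G -> g \notin A -> z \in L ->
       exists2 y, y \in A & exists2 k, k \in K & z = (k * [~ y, g])%g) ->
    K \subset cfker 'chi_i -> ~~ (L \subset cfker 'chi_i) ->
  'chi_i 1%g = #|G : A|%:R.
Proof.
move=> nsAG sKA nsLG sLA sA'K LE sKi nLi.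
have [j jA] := constt_cfRes_irr A i.
have sKj : K \subset cfker 'chi_j.
  apply: subset_trans (cfker_constt (cfRes_char _ (irr_char i)) jA).
  exact: sub_cfker_Res.
have linj : 'chi_j \is a linear_char.
  by rewrite lin_irr_der1; apply: subset_trans sA'K sKj.
have nLj : ~~ (L \subset cfker 'chi_j).
  (* If lam were trivial on L, the trivial character of the normal subgroup L would be a constituent
     of the restriction of ['chi_i], forcing L into its kernel. *)
  apply: contra nLi => sLj; apply: constt0_Res_cfker => //.
  have R1 : 'Res[L] 'chi_j = 'chi_0.
    rewrite irr0; apply/cfun_inP => x Lx; rewrite cfResE // cfun1E Lx.
    by rewrite (cfker1 (subsetP sLj _ Lx)) (lin_char1 linj).
  rewrite -(cfResRes 'chi_i sLA (normal_sub nsAG)).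
  apply: (constt_Res_trans (cfRes_char _ (irr_char i)) jA).
  by rewrite R1 constt_irr inE.
have sIA : 'I_G['chi_j]%g \subset A.
  apply/subsetP=> g /setIP[Gg Ig]; apply: contraR nLj => nAg.
  apply/subsetP=> z Lz; have [y Ay [k Kk ->]] := LE g z Gg nAg Lz.
  have nAg' : g \in 'N(A)%g by rewrite (subsetP (normal_norm nsAG)).
  have Ayg : (y ^ g)%g \in A by rewrite memJ_norm.
  have Ak := subsetP sKA _ Kk.
  apply: groupM; first exact: (subsetP sKj).
  rewrite /= cfkerEirr inE lin_char1 //.
  (* As g fixes lam, lam(y^-1 y^g) = 1. *)
  rewrite commgEl lin_charM ?groupV // inertia_valJ // -lin_charM ?groupV //.
  by rewrite mulVg lin_char1.
(* Since the inertia group is A, the Clifford correspondence is induction from A to G. *)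
have irrI : 'Ind[G] 'chi_j \in irr G.
  have /group_inj defA : 'I_G['chi_j]%g = A.
    by apply/eqP; rewrite eqEsubset sIA sub_Inertia ?normal_sub.
  have [] := constt_Inertia_bijection j nsAG; rewrite defA cfInd_id => -> //.
  by rewrite constt_irr !inE.
have : i \in irr_constt ('Ind[G] 'chi_j) by rewrite constt_Ind_Res.
rewrite -(cfIirrE irrI) constt_irr inE => /eqP ->.
by rewrite cfIirrE // cfInd1 ?normal_sub // lin_char1 // mulr1.
Qed.

(** These characters are the inflations of those of G / K. *)
Lemma sum_irr1_sqr_quo K : K <| G ->
  \sum_(i : Iirr G | K \subset cfker 'chi_i) 'chi_i 1%g ^+ 2 = #|G : K|%:R.
Proof.
move=> nsKG; have nKG := normal_norm nsKG.
transitivity (\sum_(i : Iirr (G / K)) 'chi_i 1%g ^+ 2).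
  rewrite (reindex _ (mod_Iirr_bij nsKG)); apply: eq_big => i.
    by rewrite mod_IirrE // cfker_mod.
  by rewrite mod_IirrE // cfMod1.
by rewrite irr_sum_square card_quotient.
Qed.

(** Among the characters of G / K, those trivial on L are the ones of G / L; the difference of the
    two sums of squares counts the others, all of degree N. *)
Lemma card_irr_between K L N : K <| G -> L <| G -> K \subset L ->
    (forall i : Iirr G, K \subset cfker 'chi_i -> ~~ (L \subset cfker 'chi_i) ->
       'chi_i 1%g = N%:R) ->
  (#|[set i : Iirr G | (K \subset cfker 'chi_i) && ~~ (L \subset cfker 'chi_i)]|
     * N ^ 2 + #|G : L| = #|G : K|)%N.
Proof.
move=> nsKG nsLG sKL E; apply/eqP; rewrite -eqC_nat natrD natrM.
rewrite -!sum_irr1_sqr_quo // [X in _ == X](bigID (fun i => L \subset cfker 'chi_i)) /=.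
rewrite [X in _ == X]addrC; apply/eqP; congr (_ + _); last first.
  by apply: eq_bigl => i; rewrite andb_idl //; apply: subset_trans.
under [RHS]eq_bigr => i /andP[Ki Li] do rewrite (E i Ki Li).
rewrite sumr_const natrX -[RHS]mulr_natl; congr (_%:R * _).
by apply: eq_card => i; rewrite !inE.
Qed.

Lemma card_irr_deg_eq (T : pred (Iirr G)) (d n : nat) :
    (forall i, T i -> 'chi_i 1%g = d%:R) ->
  #|[set i | T i & 'chi_i 1%g == n%:R]| = ((n == d) * #|[set i | T i]|)%N.
Proof.
move=> Td; have [->|nd] := eqVneq n d.
  by rewrite mul1n; apply: eq_card => i; rewrite !inE andb_idr // => /Td->.
apply: eq_card0 => i; rewrite !inE; apply/andP=> -[/Td->].
by rewrite eqC_nat eq_sym (negbTE nd).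
Qed.

Lemma card_irr_linear K : K <| G -> (G^`(1))%g \subset K ->
  #|[set i : Iirr G | K \subset cfker 'chi_i]| = #|G : K|.
Proof.
move=> nsKG sG'K; apply/eqP; rewrite -eqC_nat -sum_irr1_sqr_quo //.
rewrite (eq_bigr (fun=> 1)) => [|i Ki]; last first.
  by rewrite lin_char1 ?expr1n // lin_irr_der1 (subset_trans sG'K).
by rewrite sumr_const; apply/eqP; congr (_%:R); apply: eq_card => i; rewrite !inE.
Qed.

End IrrDegrees.

(** * The bilinear form and Eichler-Siegel transformations *)

Section BilinearForm.
Variables (F : fieldType) (N : nat).
Local Notation V := 'cV[F]_N.+1.
Local Notation M := 'M[F]_N.+1.
Implicit Types (x y z : V) (c : F).

(* The paper's beta: [rev_ord] exchanges the positions of e_i and e_(-i). *)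
Definition bf x y : F := \sum_i x i 0 * y (rev_ord i) 0.

Lemma bfC x y : bf x y = bf y x.
Proof.
rewrite /bf (reindex_inj rev_ord_inj); apply: eq_bigr => i _.
by rewrite rev_ordK mulrC.
Qed.

Lemma bfDr x y z : bf x (y + z) = bf x y + bf x z.
Proof. by rewrite -big_split; apply: eq_bigr => i _; rewrite !mxE mulrDr. Qed.

Lemma bfZr c x y : bf x (c *: y) = c * bf x y.
Proof. by rewrite mulr_sumr; apply: eq_bigr => i _; rewrite !mxE mulrCA. Qed.

Lemma bfDl x y z : bf (y + z) x = bf y x + bf z x.
Proof. by rewrite bfC bfDr !(bfC x). Qed.

Lemma bfZl c x y : bf (c *: y) x = c * bf y x.
Proof. by rewrite bfC bfZr (bfC x). Qed.

Lemma bfNr x y : bf x (- y) = - bf x y.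
Proof. by rewrite -scaleN1r bfZr mulN1r. Qed.

Lemma bfNl x y : bf (- x) y = - bf x y.
Proof. by rewrite -scaleN1r bfZl mulN1r. Qed.

Lemma bf0r x : bf x 0 = 0.
Proof. by rewrite -(scale0r x) bfZr mul0r. Qed.

Lemma bf0l x : bf 0 x = 0.
Proof. by rewrite bfC bf0r. Qed.

Definition bfE := (bfDr, bfDl, bfZr, bfZl, bfNr, bfNl, bf0r, bf0l).

Lemma bf_deltal i x : bf (delta_mx i 0) x = x (rev_ord i) 0.
Proof.
rewrite /bf (bigD1 i) //= big1 ?addr0 => [|k ki]; first by rewrite !mxE !eqxx mul1r.
by rewrite !mxE (negbTE ki) mul0r.
Qed.

Lemma bf_nondegenerate x : (forall y, bf x y = 0) -> x = 0.
Proof.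
by move=> x0; apply/colP=> i; rewrite -(rev_ordK i) -bf_deltal bfC x0 !mxE.
Qed.

(** The functional [bf y] as a row, so that [x *m sharp y] is a rank one map. *)
Definition sharp y : 'rV[F]_N.+1 := \row_i y (rev_ord i) 0.

Lemma mul_sharp x y z : x *m sharp y *m z = bf y z *: x.
Proof.
rewrite -mulmxA; suff -> : sharp y *m z = (bf y z)%:M by rewrite mul_mx_scalar.
apply/matrixP=> i j; rewrite !ord1 !mxE bfC eqxx mulr1n.
by apply: eq_bigr => k _; rewrite mxE mulrC.
Qed.

Lemma eq_mulmx_col (A B : M) : (forall x, A *m x = B *m x) -> A = B.
Proof.
move=> E; apply/row_matrixP=> i; apply/trmx_inj/colP=> j.
by have /colP/(_ i) := E (delta_mx j 0); rewrite -!colE !mxE.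
Qed.

(** The skew map usually identified with the bivector of x and y; the root vectors have this form by
    [emx_wedge]. *)
Definition wedge x y : M := x *m sharp y - y *m sharp x.

Lemma mul_wedge x y z : wedge x y *m z = bf y z *: x - bf x z *: y.
Proof. by rewrite mulmxBl !mul_sharp. Qed.

Lemma wedgeDr x y z : wedge x (y + z) = wedge x y + wedge x z.
Proof.
apply: eq_mulmx_col => u; rewrite [in RHS]mulmxDl !mul_wedge !bfE.
by apply/colP=> i; rewrite !mxE; ring.
Qed.

Lemma wedgeZr x c y : wedge x (c *: y) = c *: wedge x y.
Proof.
apply: eq_mulmx_col => u; rewrite -scalemxAl !mul_wedge !bfE.
by apply/colP=> i; rewrite !mxE; ring.
Qed.

Lemma wedge0r x : wedge x 0 = 0.
Proof. by rewrite -(scale0r x) wedgeZr scale0r. Qed.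

(* The exponential of [wedge e w] when [bf e e = bf e w = 0]. *)
Definition siegel e w : M := 1%:M + wedge e w - (bf w w / 2%:R) *: (e *m sharp e).

Lemma mul_siegel e w x :
  siegel e w *m x = x + bf w x *: e - bf e x *: w - (bf w w / 2%:R * bf e x) *: e.
Proof.
by rewrite mulmxBl mulmxDl mul1mx mul_wedge -scalemxAl mul_sharp scalerA addrA.
Qed.

Lemma siegel0 e : siegel e 0 = 1%:M.
Proof.
apply: eq_mulmx_col => x; rewrite mul_siegel mul1mx !bfE.
by rewrite scale0r scaler0 !mul0r scale0r !subr0 addr0.
Qed.

(** The maps [wedge e w] and [wedge e w'] commute: either product is - bf w w' times [e *m sharp e],
    the polarized quadratic term of [siegel]. *)
Lemma siegelD e w w' : 2%:R != 0 :> F -> bf e e = 0 -> bf e w = 0 -> bf e w' = 0 ->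
  siegel e (w + w') = siegel e w *m siegel e w'.
Proof.
move=> n2 ee ew ew'; apply: eq_mulmx_col => x.
rewrite -mulmxA !mul_siegel !bfE ee ew' (bfC w e) ew (bfC w' w).
by apply/colP=> i; rewrite !mxE; field.
Qed.

(* g S_e(w) g^-1 = S_(g e)(g w) for the isometry g = S_f(v), which fixes e. *)
Lemma siegelJ e f w v : 2%:R != 0 :> F -> bf f f = 0 -> bf e f = 0 ->
    bf f v = 0 -> bf e v = 0 ->
  siegel f v *m siegel e w = siegel e (siegel f v *m w) *m siegel f v.
Proof.
move=> n2 ff ef fv ev; apply: eq_mulmx_col => x.
rewrite -!mulmxA !mul_siegel !bfE (bfC f e) (bfC v e) (bfC v f).
rewrite (bfC w f) (bfC w v) ff ef fv ev.
by apply/colP=> i; rewrite !mxE; field.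
Qed.

End BilinearForm.

(** * The exponential of a sum of two wedges *)

Section Exponential.
Variables (F : fieldType) (N : nat).
Local Notation V := 'cV[F]_N.+1.
Local Notation M := 'M[F]_N.+1.
Variables (e f w v : V).
Hypotheses (ee : bf e e = 0) (ff : bf f f = 0) (ef : bf e f = 0).
Hypotheses (ew : bf e w = 0) (fv : bf f v = 0) (ev : bf e v = 0).
Local Notation Z := (wedge e w + wedge f v).

(** By [mul_wedges] the image of Z lies in the span of e, f, w, v, so powers of Z come from
    iterating this formula; the zero coefficient of w keeps its shape stable under rewriting. *)
Lemma mul_wedges_comb c1 c2 c3 c4 :
  Z *m (c1 *: e + c2 *: f + c3 *: w + c4 *: v) =
    (c2 * bf f w + c3 * bf w w + c4 * bf w v) *: e
    + (c3 * bf w v + c4 * bf v v) *: f + 0 *: w + (- (c3 * bf f w)) *: v.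
Proof.
rewrite mulmxDl !mul_wedge !bfE ee ff ef ew fv ev (bfC f e) (bfC w e) (bfC w f).
rewrite (bfC v e) (bfC v f) (bfC v w) ef ew fv ev.
by apply/colP=> i; rewrite !mxE; ring.
Qed.

Lemma mul_wedges x : Z *m x =
  bf w x *: e + bf v x *: f + (- bf e x) *: w + (- bf f x) *: v.
Proof.
rewrite mulmxDl !mul_wedge.
by apply/colP=> i; rewrite !mxE; ring.
Qed.

(** Z maps the whole space successively into the spans of e, f, w, v, then of e, f, v, then of e, f,
    then of e, and finally to 0. *)
Lemma wedges_exp5 : Z ^+ 5 = 0.
Proof.
apply: eq_mulmx_col => x; rewrite mul0mx !exprS expr0 mulr1 -!mulmxE -!mulmxA.
rewrite (mul_wedges x) !mul_wedges_comb.
by apply/colP=> i; rewrite !mxE; ring.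
Qed.

(** For d = 4, where [mexp] has only four terms and W is zero. *)
Lemma wedges_exp4 : v = 0 -> Z ^+ 4 = 0.
Proof.
move=> v0; apply: eq_mulmx_col => x; rewrite mul0mx !exprS expr0 mulr1 -!mulmxE -!mulmxA.
rewrite (mul_wedges x) !mul_wedges_comb v0 !bfE.
by apply/colP=> i; rewrite !mxE; ring.
Qed.

(** Put X = wedge e w and Y = wedge f v. As Y e = 0, the bracket [Y, wedge e w] is wedge e (Y w),
    and such wedges commute. So exp(X + Y) = exp(phi(ad Y) X) exp(Y) with phi(z) = (exp(z) - 1)/z =
    1 + z/2 + z^2/6 + ..., and Y^3 = 0 stops the series. The proof checks the resulting identity on
    vectors. *)
Lemma sum_wedges_exp : 2%:R != 0 :> F -> 3%:R != 0 :> F ->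
  \sum_(k < 5) (k`!%:R)^-1 *: Z ^+ k =
    siegel e (w + (2%:R)^-1 *: (wedge f v *m w)
                + (6%:R)^-1 *: (wedge f v *m (wedge f v *m w)))
      *m siegel f v.
Proof.
move=> n2 n3.
have n6 : 6%:R != 0 :> F by rewrite -[6%N]/(2 * 3)%N natrM mulf_neq0.
have n24 : 24%:R != 0 :> F by rewrite -[24%N]/(2 * 2 * 6)%N !natrM !mulf_neq0.
apply: eq_mulmx_col => x.
rewrite -mulmxA !mul_siegel !mul_wedge !bfE ?(bfC f e) ?(bfC w f).
rewrite ?(bfC v e) ?(bfC v f) ?(bfC v w) ?ee ?ff ?ef ?ew ?fv ?ev.
rewrite mulmx_suml !big_ord_recr big_ord0 /= -!scalemxAl.
have E k y : Z ^+ k.+1 *m y = Z *m (Z ^+ k *m y) by rewrite exprS -mulmxE mulmxA.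
rewrite !E expr0 mul1mx (mul_wedges x) !mul_wedges_comb !factS fact0 !mul1n !natrM.
by apply/colP=> i; rewrite !mxE; field; rewrite n2 n6 n24 oner_neq0.
Qed.

End Exponential.

(** Every line in direction u inside S meets the hyperplane orthogonal to h exactly once. *)
Lemma card_bf_slice (F : finFieldType) N (S : {set 'cV[F]_N.+1}) h u : bf h u = 1 ->
    (forall x c, x \in S -> x + c *: u \in S) ->
  #|S| = (#|F| * #|[set x in S | (bf h x == 0)%R]|)%N.
Proof.
move=> hu clS; set S0 := [set x in S | _].
rewrite mulnC -cardsT -cardsX.
have -> : S = [set p.1 + p.2 *: u | p in setX S0 [set: F]].
  apply/setP=> x; apply/idP/imsetP => [Sx|[[y c] /setXP[]]].
    exists (x - bf h x *: u, bf h x); last by rewrite subrK.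
    by rewrite !inE -scaleNr clS //= andbT bfDr bfZr hu mulr1 subrr.
  by rewrite inE => /andP[Sy _] _ ->; apply: clS.
apply: card_in_imset => -[x c] [y d]; rewrite !inE !andbT /=.
move=> /andP[_ /eqP hx] /andP[_ /eqP hy] E.
have := congr1 (bf h) E; rewrite !bfDr !bfZr hu hx hy !add0r !mulr1 => cd.
by move: E; rewrite cd => /addIr ->.
Qed.

(** * The group of products S_e(w) S_f(v) *)

Section HeisenbergGroup.
Local Open Scope group_scope.
Local Open Scope ring_scope.
Variables (F : finFieldType) (N : nat).
Local Notation V := 'cV[F]_N.+1.
Local Notation M := 'M[F]_N.+1.
Variables (e f e' f' : V).
Hypotheses (ee : bf e e = 0) (ef : bf e f = 0) (ff : bf f f = 0).
Hypotheses (ee' : bf e e' = 1) (ef' : bf e f' = 0) (fe' : bf f e' = 0) (ff' : bf f f' = 1).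
Hypotheses (e'e' : bf e' e' = 0) (e'f' : bf e' f' = 0) (f'f' : bf f' f' = 0).
Hypothesis n2 : 2%:R != 0 :> F.

Definition W1 : {set V} := [set w | (bf e w == 0) && (bf e' w == 0)].
Definition W : {set V} := [set w in W1 | (bf f w == 0) && (bf f' w == 0)].

Lemma W1P w : reflect (bf e w = 0 /\ bf e' w = 0) (w \in W1).
Proof. by rewrite inE; apply: (iffP andP) => -[/eqP ? /eqP]. Qed.

Lemma WP w : reflect [/\ bf e w = 0, bf e' w = 0, bf f w = 0 & bf f' w = 0] (w \in W).
Proof.
rewrite inE; apply: (iffP andP) => [[/W1P[-> ->] /andP[/eqP-> /eqP->]]|[? ? -> ->]] //.
by rewrite eqxx; split=> //; apply/W1P.
Qed.

Lemma W_W1 w : w \in W -> w \in W1.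
Proof. by case/setIdP. Qed.

Lemma W1D w w' : w \in W1 -> w' \in W1 -> w + w' \in W1.
Proof. by move=> /W1P[a b] /W1P[c d]; apply/W1P; rewrite !bfE a b c d !addr0. Qed.

Lemma W1N w : w \in W1 -> - w \in W1.
Proof. by move=> /W1P[a b]; apply/W1P; rewrite !bfE a b !oppr0. Qed.

Lemma WD w w' : w \in W -> w' \in W -> w + w' \in W.
Proof.
by move=> /WP[a b c d] /WP[a' b' c' d']; apply/WP; rewrite !bfE a b c d a' b' c' d' !addr0.
Qed.

Lemma W1_0 : 0 \in W1. Proof. by apply/W1P; rewrite !bf0r. Qed.
Lemma W_0 : 0 \in W. Proof. by apply/WP; rewrite !bf0r. Qed.

Lemma W1Zf c : c *: f \in W1.
Proof. by apply/W1P; rewrite !bfZr ef bfC fe' !mulr0. Qed.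

Lemma bf_siegel_f v w : v \in W -> bf f (siegel f v *m w) = bf f w.
Proof. by case/WP=> _ _ fv _; rewrite mul_siegel !bfE ff fv; ring. Qed.

Lemma siegel_W1 v w : v \in W -> w \in W1 -> siegel f v *m w \in W1.
Proof.
move=> /WP[ev e'v fv _] /W1P[ew e'w]; apply/W1P.
rewrite mul_siegel !bfE ef (bfC e' f) fe' ev e'v ew e'w.
by split; ring.
Qed.

(* Junk value 1 when the product is not invertible, which does not happen on W1 x W. *)
Definition hs w v : {unit M} := insubd (1%g : {unit M}) (siegel e w *m siegel f v).

Lemma siegel_unit (a w : V) : bf a a = 0 -> bf a w = 0 -> siegel a w \in unitmx.
Proof.
move=> aa aw; have := siegelD n2 aa aw (_ : bf a (- w) = 0).
by rewrite bfNr aw oppr0 subrr siegel0 => /(_ erefl)/esym/mulmx1_unit[].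
Qed.

Lemma val_hs w v : w \in W1 -> v \in W -> val (hs w v) = siegel e w *m siegel f v.
Proof.
move=> /W1P[ew _] /WP[_ _ fv _]; rewrite val_insubd.
by rewrite [_ \is a GRing.unit]unitmx_mul !siegel_unit.
Qed.

Lemma hsM w v w' v' : w \in W1 -> v \in W -> w' \in W1 -> v' \in W ->
  (hs w v * hs w' v')%g = hs (w + siegel f v *m w') (v + v').
Proof.
move=> ww vv ww' vv'; apply: val_inj.
rewrite [LHS]FinRing.val_unitM !val_hs ?WD ?W1D ?siegel_W1 //.
have [/W1P[ew _] /W1P[ew' _]] := (ww, ww').
have [/WP[ev _ fv _] /WP[_ _ fv' _]] := (vv, vv').
have /W1P[eS _] := siegel_W1 vv ww'.
rewrite !siegelD // -!mulmxE -!mulmxA; congr (_ *m _).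
by rewrite !mulmxA (@siegelJ _ _ e f).
Qed.

Lemma hs0 : hs 0 0 = 1%g.
Proof. by apply: val_inj; rewrite val_hs ?W1_0 ?W_0 // !siegel0 mulmx1. Qed.

(** S_f(v) fixes e', so the product sends e' to e' - w plus a multiple of e; pairing with e'
    determines this multiple, hence w. Then S_e(w) cancels, and f' recovers v in the same way. *)
Lemma hs_inj w v w' v' : w \in W1 -> v \in W -> w' \in W1 -> v' \in W ->
  hs w v = hs w' v' -> w = w' /\ v = v'.
Proof.
move=> ww vv ww' vv' /(congr1 val); rewrite !val_hs // => E.
have [/W1P[ew e'w] /W1P[ew' e'w']] := (ww, ww').
have [/WP[ev e'v fv f'v] /WP[ev' e'v' fv' f'v']] := (vv, vv').
have eqw : w = w'.
  have E0 u : u \in W -> siegel f u *m e' = e'.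
    move=> /WP[_ e'u _ _]; rewrite mul_siegel (bfC u) e'u fe'.
    by rewrite mulr0 !scale0r !subr0 addr0.
  have : siegel e w *m e' = siegel e w' *m e'.
    by rewrite -[in LHS](E0 v vv) -[in RHS](E0 v' vv') !mulmxA E.
  rewrite !mul_siegel ee' (bfC w) (bfC w') e'w e'w' !scale0r !addr0 !scale1r !mulr1 => E1.
  have := congr1 (bf e') E1; rewrite !bfE e'w e'w' (bfC e' e) ee' e'e' !mulr1.
  move/addrI/oppr_inj => s; move: E1; rewrite s => /addIr/addrI/oppr_inj ->//.
split=> //; move: E; rewrite eqw => E.
have {}E : siegel f v = siegel f v'.
  by apply: (can_inj (mulKmx (siegel_unit ee ew'))).
have := congr1 (mulmx^~ f') E; rewrite !mul_siegel ff' !(bfC _ f') f'v f'v'.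
rewrite !scale0r !addr0 !scale1r !mulr1 => E1.
have := congr1 (bf f') E1; rewrite !bfE f'v f'v' (bfC f' f) ff' f'f' !mulr1.
by move/addrI/oppr_inj => s; move: E1; rewrite s => /addIr/addrI/oppr_inj.
Qed.

(** The first factor on the right is the conjugate of [hs w v] by [hs w' v']; it keeps the
    coordinate v because second coordinates simply add up. *)
Lemma hs_swap w v w' v' : w \in W1 -> v \in W -> w' \in W1 -> v' \in W ->
  (hs w' v' * hs w v = hs (w' - siegel f v *m w' + siegel f v' *m w) v * hs w' v')%g.
Proof.
move=> ww vv ww' vv'; rewrite !hsM ?W1D ?W1N ?siegel_W1 //.
by rewrite addrAC subrK [v' + v]addrC.
Qed.

(** Subgroups are given by their coordinates (w, v), so that membership, orders and normality become
    statements about vectors. *)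
Definition hset (B : {set V * V}) : {set {unit M}} := [set hs p.1 p.2 | p in B].

Lemma hsetP (B : {set V * V}) (g : {unit M}) :
  reflect (exists w v, (w, v) \in B /\ g = hs w v) (g \in hset B).
Proof.
by apply: (iffP imsetP) => [[[w v] ? ->]|[w [v [? ->]]]]; [exists w, v|exists (w, v)].
Qed.

Lemma mem_hset (B : {set V * V}) w v : B \subset setX W1 W -> w \in W1 -> v \in W ->
  (hs w v \in hset B) = ((w, v) \in B).
Proof.
move=> sB ww vv; apply/hsetP/idP => [[w1 [v1 [B1 E]]]|Bwv]; last by exists w, v.
have /setXP[w1W v1W] := subsetP sB _ B1.
by have [-> ->] := hs_inj ww vv w1W v1W E.
Qed.

Lemma card_hset (B : {set V * V}) : B \subset setX W1 W -> #|hset B| = #|B|.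
Proof.
move=> /subsetP sB; apply: card_in_imset => -[w v] [w' v'] /sB/setXP[a b] /sB/setXP[c d].
by move=> /= /hs_inj-/(_ a b c d)[-> ->].
Qed.

Lemma hset_group (B : {set V * V}) : B \subset setX W1 W -> (0, 0) \in B ->
    (forall w v w' v', (w, v) \in B -> (w', v') \in B ->
       (w + siegel f v *m w', v + v') \in B) ->
  group_set (hset B).
Proof.
move=> /subsetP sB B0 Bop; apply/group_setP; split=> [|g h].
  by apply/hsetP; exists 0, 0; rewrite hs0.
move=> /hsetP[w [v [B1 ->]]] /hsetP[w' [v' [B2 ->]]]; apply/hsetP.
exists (w + siegel f v *m w'), (v + v'); split; first exact: Bop.
by have [/setXP[? ?] /setXP[? ?]] := (sB _ B1, sB _ B2); rewrite hsM.
Qed.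

Lemma hset_normal (B : {set V * V}) (G H : {group {unit M}}) :
    G :=: hset (setX W1 W) -> H :=: hset B -> B \subset setX W1 W ->
    (forall w v w' v', (w, v) \in B -> w' \in W1 -> v' \in W ->
       (w' - siegel f v *m w' + siegel f v' *m w, v) \in B) ->
  H <| G.
Proof.
move=> defG defH sB Bop; apply/andP; split.
  by rewrite defG defH; apply: imsetS.
have nH g x : g \in G -> x \in H -> (x ^ g^-1)%g \in H.
  rewrite defG defH => /hsetP[w' [v' [/setXP[w'W v'W] ->]]] /hsetP[w [v [Bwv ->]]].
  have /setXP[wW vW] := subsetP sB _ Bwv.
  rewrite conjgE invgK mulgA hs_swap // mulgK.
  by apply/hsetP; exists (w' - siegel f v *m w' + siegel f v' *m w), v; rewrite Bop.
apply/subsetP=> g Gg; rewrite inE; apply/subsetP=> _ /imsetP[x Hx ->].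
by rewrite -[g]invgK nH ?groupV.
Qed.

(** The first coordinate of g h g^-1 h^-1 for g = [hs w' v'] and h = [hs w v]; the second one is
    0. *)
Definition hcomm w' v' w v : V := w' - siegel f v *m w' + siegel f v' *m w - w.

(** This form controls the derived subgroups of A, B and G: it vanishes if v = v' = 0, is a multiple
    of f if w and w' are orthogonal to f, and is orthogonal to f for all v and v' in W. *)
Lemma hcommE w' v' w v : hcomm w' v' w v =
  (bf v' w - bf v w' + bf v v / 2%:R * bf f w' - bf v' v' / 2%:R * bf f w) *: f
    + bf f w' *: v - bf f w *: v'.
Proof. by rewrite /hcomm !mul_siegel; apply/colP=> i; rewrite !mxE; ring. Qed.

Lemma hcomm_W1 w' v' w v : w \in W1 -> v \in W -> w' \in W1 -> v' \in W ->
  hcomm w' v' w v \in W1.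
Proof. by move=> *; rewrite !(W1D, W1N, siegel_W1). Qed.

(** The commutator x^-1 y^-1 x y is taken at inverses so as to read g h g^-1 h^-1, to which
    [hs_swap] applies. *)
Lemma hs_comm w v w' v' : w \in W1 -> v \in W -> w' \in W1 -> v' \in W ->
  [~ (hs w' v')^-1, (hs w v)^-1]%g = hs (hcomm w' v' w v) 0.
Proof.
move=> ww vv ww' vv'; rewrite commgEl conjgE !invgK !mulgA hs_swap //.
rewrite mulgK -[RHS](mulgK (hs w v)) hsM ?W_0 ?hcomm_W1 // siegel0 mul1mx add0r.
by rewrite /hcomm subrK.
Qed.

Lemma der1_hset (B C : {set V * V}) (A K : {group {unit M}}) :
    A :=: hset B -> K :=: hset C -> B \subset setX W1 W ->
    (forall w v w' v', (w, v) \in B -> (w', v') \in B -> (hcomm w' v' w v, 0) \in C) ->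
  (A^`(1))%g \subset K.
Proof.
move=> defA defK /subsetP sB BC; rewrite gen_subG.
apply/subsetP=> _ /imset2P[x y Ax Ay ->].
rewrite -[x]invgK -[y]invgK; move: Ax Ay; rewrite -groupV -[y \in A]groupV defA.
move=> /hsetP[w' [v' [B1 ->]]] /hsetP[w [v [B2 ->]]].
have [/setXP[? ?] /setXP[? ?]] := (sB _ B1, sB _ B2).
rewrite hs_comm // defK; apply/hsetP.
by exists (hcomm w' v' w v), 0; split=> //; apply: BC.
Qed.

(** Some z pairs nontrivially with v; its projection to W along the two hyperbolic planes has the
    same pairing, v being orthogonal to both planes. *)
Lemma W_nondegenerate v : v \in W -> v != 0 -> exists2 w, w \in W & bf v w != 0.
Proof.
move=> /WP[ev e'v fv f'v] v0.
case: (pickP [pred z | bf v z != 0]) => [z /= vz|v_z]; last first.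
  case/eqP: v0; apply: bf_nondegenerate => z.
  by have /negbFE/eqP := v_z z.
exists (z - bf e' z *: e - bf e z *: e' - bf f' z *: f - bf f z *: f').
  apply/WP; rewrite !bfE ee ff ef ee' ff' ef' fe' e'e' e'f' f'f'.
  rewrite (bfC e' e) (bfC e' f) (bfC f e) (bfC f' e) (bfC f' e') (bfC f' f).
  by rewrite ee' fe' ef ef' e'f' ff'; split; ring.
by rewrite !bfE !(bfC v) ev e'v fv f'v !mulr0 !subr0 bfC.
Qed.

Definition W2 : {set V} := [set w in W1 | bf f w == 0].
Definition lineF : {set V} := [set c *: f | c : F].

Lemma mem_lineF c : c *: f \in lineF.
Proof. exact: imset_f. Qed.

Lemma card_W2 : #|W2| = (#|F| * #|W|)%N.
Proof.
rewrite (@card_bf_slice _ _ W2 f' f); last 2 first.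
- by rewrite bfC.
- move=> x c /setIdP[xW /eqP fx]; rewrite inE W1D ?W1Zf //.
  by rewrite !bfE fx ff mulr0 addr0 eqxx.
by congr (_ * _)%N; apply: eq_card => w; rewrite !inE !andbA.
Qed.

Lemma card_W1 : #|W1| = (#|F| ^ 2 * #|W|)%N.
Proof.
rewrite (@card_bf_slice _ _ W1 f f') // -/W2 ?card_W2 ?mulnA ?mulnn //.
move=> x c xW; rewrite W1D //; apply/W1P.
by rewrite !bfE ef' e'f' !mulr0.
Qed.

Lemma card_lineF : #|lineF| = #|F|.
Proof.
apply: card_imset => c d /(congr1 (bf f')).
by rewrite !bfE bfC ff' !mulr1.
Qed.

(** Slicing along e', e and then, through [card_W1], along f', f divides the count by q four
    times. *)
Lemma card_space : #|{: V}| = (#|F| ^ 4 * #|W|)%N.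
Proof.
rewrite -cardsT (@card_bf_slice _ _ [set: V] e e') //; last by move=> *; rewrite inE.
rewrite (@card_bf_slice _ _ [set x in [set: V] | bf e x == 0] e' e); last 2 first.
- by rewrite bfC.
- by move=> x c; rewrite !inE !bfE ee mulr0 addr0.
have -> : [set x in [set x in [set: V] | bf e x == 0] | bf e' x == 0] = W1.
  by apply/setP=> w; rewrite !inE.
by rewrite card_W1 -[4%N]/(1 + 1 + 2)%N !expnD !expn1 -!mulnA.
Qed.

Local Notation BZ := (setX lineF [set (0 : V)]).
Local Notation BU := (setX W2 [set (0 : V)]).
Local Notation BA := (setX W1 [set (0 : V)]).
Local Notation BM := (setX W2 W).
Local Notation BG := (setX W1 W).

Lemma W2P w : reflect (w \in W1 /\ bf f w = 0) (w \in W2).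
Proof. by apply: (iffP setIdP) => -[? /eqP]. Qed.

Lemma lineF_W2 : lineF \subset W2.
Proof.
apply/subsetP=> _ /imsetP[c _ ->]; apply/W2P.
by rewrite W1Zf !bfE ff mulr0.
Qed.

Lemma W2_W1 : W2 \subset W1.
Proof. by apply/subsetP=> w /W2P[]. Qed.

Lemma zero_W : [set (0 : V)] \subset W.
Proof. by rewrite sub1set W_0. Qed.

Lemma mul_siegel0 (w : V) : siegel f 0 *m w = w.
Proof. by rewrite siegel0 mul1mx. Qed.

Lemma mul_siegel_self v : v \in W -> siegel f v *m f = f.
Proof.
case/WP=> _ _ fv _; rewrite mul_siegel bfC fv ff mulr0 !scale0r.
by rewrite !subr0 addr0.
Qed.

Lemma hsetS (B C : {set V * V}) : B \subset C -> hset B \subset hset C.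
Proof. exact: imsetS. Qed.

Lemma ex_hset (B : {set V * V}) : B \subset BG -> (0, 0) \in B ->
    (forall w v w' v', (w, v) \in B -> (w', v') \in B ->
       (w + siegel f v *m w', v + v') \in B) ->
  exists H : {group {unit M}}, H :=: hset B.
Proof. by move=> sB B0 Bop; exists (Group (hset_group sB B0 Bop)). Qed.

(** * The irreducible characters of the group *)

Section Characters.
Variables (G : {group {unit M}}) (m : nat).
Hypotheses (defG : G :=: hset BG) (cardW : #|W| = (#|F| ^ m)%N).
Local Notation q := #|F|.

Let q_gt0 : (0 < q)%N. Proof. by apply/card_gt0P; exists 0. Qed.

Lemma index_hset (H : {group {unit M}}) (B : {set V * V}) k : H :=: hset B -> B \subset BG ->
  (q ^ k * #|B| = q ^ (m + m + 2))%N -> #|G : H| = (q ^ k)%N.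
Proof.
move=> defH sB E.
have sHG : H \subset G by rewrite defG defH hsetS.
have cH : #|H| = #|B| by rewrite defH card_hset.
have cG : #|G| = (q ^ (m + m + 2))%N.
  by rewrite defG card_hset // cardsX card_W1 cardW -!expnD -addnA addnC.
apply/eqP; rewrite -(eqn_pmul2l (cardG_gt0 H)) Lagrange // cG cH -E mulnC.
exact: eqxx.
Qed.

(** The three contributions are added because the degrees may coincide: q^m is 1 for m = 0 and q for
    m = 1. *)
Lemma card_irr_hset k :
  #|[set i : Iirr G | 'chi_i 1%g == (q ^ k)%N%:R]|
    = ((q ^ k == q ^ m) * (q * q.-1) + (q ^ k == q) * (q ^ m.-1 * (q ^ m).-1)
       + (q ^ k == 1) * q ^ m.+1)%N.
Proof.
have sZU : BZ \subset BU by apply: setXS; rewrite ?lineF_W2.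
have sUA : BU \subset BA by apply: setXS; rewrite ?W2_W1 ?zero_W.
have sUM : BU \subset BM by apply: setXS; rewrite ?zero_W.
have sAG : BA \subset BG by apply: setXS; rewrite ?zero_W.
have sMG : BM \subset BG by apply: setXS; rewrite ?W2_W1 ?zero_W.
have sUG := subset_trans sUA sAG; have sZG := subset_trans sZU sUG.
have lF0 : 0 \in lineF by rewrite -(scale0r f) mem_lineF.
have W20 : 0 \in W2 := subsetP lineF_W2 _ lF0.
have lFD w w' : w \in lineF -> w' \in lineF -> w + w' \in lineF.
  by move=> /imsetP[c _ ->] /imsetP[d _ ->]; rewrite -scalerDl mem_lineF.
have W2D w w' : w \in W2 -> w' \in W2 -> w + w' \in W2.
  by move=> /W2P[a b] /W2P[c d]; apply/W2P; rewrite W1D ?bfE ?b ?d ?addr0.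
have [Z defZ] : exists H : {group {unit M}}, H :=: hset BZ.
  apply: ex_hset => // [|w v w' v' /setXP[a /set1P->] /setXP[b /set1P->]].
    by apply/setXP; rewrite lF0 set11.
  by rewrite mul_siegel0 addr0; apply/setXP; rewrite lFD ?set11.
have [U defU] : exists H : {group {unit M}}, H :=: hset BU.
  apply: ex_hset => // [|w v w' v' /setXP[a /set1P->] /setXP[b /set1P->]].
    by apply/setXP; rewrite W20 set11.
  by rewrite mul_siegel0 addr0; apply/setXP; rewrite W2D ?set11.
have [A defA] : exists H : {group {unit M}}, H :=: hset BA.
  apply: ex_hset => // [|w v w' v' /setXP[a /set1P->] /setXP[b /set1P->]].
    by apply/setXP; rewrite W1_0 set11.
  by rewrite mul_siegel0 addr0; apply/setXP; rewrite W1D ?set11.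
have [B defB] : exists H : {group {unit M}}, H :=: hset BM.
  apply: ex_hset => // [|w v w' v' /setXP[/W2P[a fw] b] /setXP[/W2P[c fw'] d]].
    by apply/setXP; rewrite W20 W_0.
  apply/setXP; split; last exact: WD.
  by apply/W2P; rewrite W1D ?siegel_W1 // bfDr bf_siegel_f // fw fw' addr0.
have nZG : Z <| G.
  apply: (hset_normal defG defZ) => // w v w' v' /setXP[/imsetP[c _ ->] /set1P->] _ ?.
  rewrite mul_siegel0 subrr add0r -scalemxAr mul_siegel_self //.
  by apply/setXP; rewrite set11 mem_lineF.
have nUG : U <| G.
  apply: (hset_normal defG defU) => // w v w' v' /setXP[/W2P[a fw] /set1P->] _ ?.
  rewrite mul_siegel0 subrr add0r; apply/setXP; rewrite set11; split=> //.
  by apply/W2P; rewrite siegel_W1 // bf_siegel_f.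
have nAG : A <| G.
  apply: (hset_normal defG defA) => // w v w' v' /setXP[a /set1P->] _ ?.
  rewrite mul_siegel0 subrr add0r; apply/setXP; rewrite set11.
  by rewrite siegel_W1.
have nBG : B <| G.
  apply: (hset_normal defG defB) => // w v w' v' /setXP[/W2P[a fw] ?] ? ?.
  apply/setXP; split=> //; apply/W2P.
  by rewrite !(W1D, W1N, siegel_W1) // !bfE !bf_siegel_f // fw; split=> //; ring.
have ssZU : Z \subset U by rewrite defZ defU hsetS.
have indU : #|G : U| = (q ^ m.+1)%N.
  apply: index_hset defU _ _ => //.
  by rewrite cardsX cards1 muln1 card_W2 cardW -expnS -expnD addnS addn2.
have indZ : #|G : Z| = (q ^ (m + m).+1)%N.
  apply: index_hset defZ _ _ => //.
  by rewrite cardsX cards1 muln1 card_lineF -expnSr addn2.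
have indA : #|G : A| = (q ^ m)%N.
  apply: index_hset defA _ _ => //.
  by rewrite cardsX cards1 muln1 card_W1 cardW -!expnD addnCA addnC.
have indB : #|G : B| = (q ^ 1)%N.
  apply: index_hset defB _ _ => //.
  by rewrite cardsX card_W2 cardW -expnS -!expnD add1n addSn addn2.
have ind1 : #|G : 1%G| = (q ^ (m + m).+2)%N.
  have defI : 1%G :=: hset [set ((0, 0) : V * V)] by rewrite /hset imset_set1 hs0.
  apply: index_hset defI _ _ => //; last by rewrite cards1 muln1 addn2.
  by rewrite sub1set; apply/setXP; rewrite W1_0 W_0.
(* Elements outside a subgroup are presented as inverses, to match [hs_comm]. *)
have outside (H : {group {unit M}}) C g : H :=: hset C -> C \subset BG ->
    g \in G -> g \notin H ->
  exists w v, [/\ w \in W1, v \in W, (w, v) \notin C & g = (hs w v)^-1%g].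
  move=> defH sC; rewrite -groupV -(groupV H) defG defH.
  move=> /hsetP[w [v [/setXP[ww vv] E]]]; rewrite E mem_hset // => nC.
  by exists w, v; rewrite -E invgK.
have degA i : ~~ (Z \subset cfker 'chi[G]_i) -> 'chi_i 1%g = (q ^ m)%:R.
  move=> nZi; rewrite -indA; apply: (irr1_index nAG (sub1G A) nZG) => //.
  - by rewrite defZ defA hsetS ?(subset_trans sZU sUA).
  - have defI : 1%G :=: hset [set ((0, 0) : V * V)] by rewrite /hset imset_set1 hs0.
    apply: (der1_hset defA defI) => // w v w' v' /setXP[? /set1P->] /setXP[? /set1P->].
    by rewrite hcommE !bfE !(mul0r, subrr, addr0, scale0r, scaler0) set11.
  - move=> g z Gg nAg; rewrite defZ => /hsetP[_ [_ [/setXP[/imsetP[c _ ->] /set1P->] ->]]].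
    have [w [v [ww vv nA ->]]] := outside _ _ _ defA sAG Gg nAg.
    have vn0 : v != 0.
      by apply: contraNneq nA => ->; apply/setXP; rewrite ww set11.
    have [x xW vx] := W_nondegenerate vv vn0.
    (* For x' in W, the commutator coordinate [hcomm x' 0 w v] is - bf v x' times f; x' is scaled to
       make it c f. *)
    have x'W : - (c / bf v x) *: x \in W.
      by apply/WP; have /WP[xe xe' xf xf'] := xW; rewrite !bfZr xe xe' xf xf' !mulr0.
    exists (hs (- (c / bf v x) *: x) 0)^-1%g.
      rewrite groupV defA mem_hset ?W_0 ?W_W1 //.
      by apply/setXP; rewrite set11 W_W1.
    exists 1%g; first exact: group1.
    rewrite mul1g hs_comm ?W_0 ?(W_W1 x'W) // hcommE.
    have /WP[_ _ fx _] := x'W.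
    rewrite fx !bfE mulNr divfK // opprK.
    by rewrite !(mul0r, mulr0, add0r, addr0, subr0, scale0r, scaler0).
  - exact: sub1G.
have degB i : Z \subset cfker 'chi[G]_i -> ~~ (U \subset cfker 'chi_i) ->
    'chi_i 1%g = (q ^ 1)%:R.
  move=> Zi nUi; rewrite -indB; apply: (irr1_index nBG _ nUG _ _ _ Zi nUi) => //.
  - by rewrite defZ defB hsetS ?(subset_trans sZU sUM).
  - by rewrite defU defB hsetS.
  - apply: (der1_hset defB defZ) => // w v w' v' /setXP[/W2P[_ fw] _] /setXP[/W2P[_ fw'] _].
    rewrite hcommE fw fw' !scale0r subr0 addr0; apply/setXP.
    by rewrite mem_lineF set11.
  - move=> g z Gg nBg; rewrite defU => /hsetP[u [_ [/setXP[/W2P[uW1 fu] /set1P->] ->]]].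
    have [w [v [ww vv nB ->]]] := outside _ _ _ defB sMG Gg nBg.
    have fw0 : bf f w != 0.
      by apply: contraNneq nB => fw; apply/setXP; split=> //; apply/W2P.
    (* Modulo f, [hcomm 0 x w v] is - bf f w times x, and this must be u. Removing from u its
       f-component puts x in W; the leftover multiple of f is absorbed by Z. *)
    set x := - (bf f w)^-1 *: (u - bf f' u *: f).
    have xW : x \in W.
      have /W1P[eu e'u] := uW1.
      apply/WP; rewrite !bfE ef (bfC e' f) fe' ff (bfC f' f) ff' eu e'u fu.
      by split; ring.
    exists (hs 0 x)^-1%g.
      rewrite groupV defB mem_hset ?W1_0 //; apply/setXP; split=> //.
    have commE : exists c, hcomm 0 x w v = u - c *: f.
      rewrite hcommE; set a := (X in X *: f + _).
      exists (bf f' u - a); rewrite bfE scale0r addr0 scalerA mulrN divff // scaleN1r opprK.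
      by apply/colP=> r; rewrite !mxE; ring.
    have [c hc] := commE.
    exists (hs (c *: f) 0).
      rewrite defZ; apply/hsetP; exists (c *: f), 0; split=> //.
      by apply/setXP; rewrite mem_lineF set11.
    rewrite hs_comm ?W1_0 // hsM ?W_0 ?W1Zf ?hcomm_W1 ?W1_0 //.
    by rewrite mul_siegel0 hc addrC subrK addr0.
have derU : (G^`(1))%g \subset U.
  apply: (der1_hset defG defU) => // w v w' v' /setXP[ww vv] /setXP[ww' vv'].
  apply/setXP; rewrite set11; split=> //; apply/W2P; rewrite hcomm_W1 //; split=> //.
  have [/WP[_ _ fv _] /WP[_ _ fv' _]] := (vv, vv').
  by rewrite hcommE !bfE ff fv fv' !mulr0 !subr0 addr0.
have cardA : #|[set i : Iirr G | ~~ (Z \subset cfker 'chi_i)]| = (q * q.-1)%N.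
  have := card_irr_between (normal1 G) nZG (sub1G Z) (fun i _ => @degA i).
  rewrite ind1 indZ => /(irr_count_top q_gt0) <-.
  by apply: eq_card => i; rewrite !inE sub1G.
have cardB : #|[set i : Iirr G | (Z \subset cfker 'chi_i) && ~~ (U \subset cfker 'chi_i)]|
    = (q ^ m.-1 * (q ^ m).-1)%N.
  have := card_irr_between nZG nUG ssZU degB.
  by rewrite indZ indU expn1 => /(irr_count_middle q_gt0).
have cardU := card_irr_linear nUG derU; rewrite indU in cardU.
have degU i : U \subset cfker 'chi[G]_i -> 'chi_i 1%g = 1%:R.
  by move=> Ui; rewrite lin_char1 // lin_irr_der1 (subset_trans derU).
have degB' i : (Z \subset cfker 'chi[G]_i) && ~~ (U \subset cfker 'chi_i) ->
    'chi_i 1%g = q%:R.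
  by move=> /andP[Zi nUi]; rewrite (degB _ Zi nUi) expn1.
rewrite -cardA -cardB -cardU.
rewrite -(card_irr_deg_eq _ degA) -(card_irr_deg_eq _ degB') -(card_irr_deg_eq _ degU).
(* Splitting by triviality on Z, then on U, gives the three families. *)
rewrite -!sum1dep_card (bigID (fun i => Z \subset cfker 'chi_i)) /= addnC -addnA.
congr (_ + _)%N; first by apply: eq_bigl => i; rewrite andbC.
rewrite (bigID (fun i => U \subset cfker 'chi_i)) /= addnC; congr (_ + _)%N.
  by apply: eq_bigl => i; rewrite -andbA andbC.
apply: eq_bigl => i; rewrite -andbA andbC; congr (_ && _).
by rewrite andb_idl // => /(subset_trans ssZU).
Qed.

End Characters.

End HeisenbergGroup.

(** * The Lie algebra in terms of wedges *)

Lemma mem_short_rootvecs (F : finFieldType) t n (x : 'M[F]_((vdim t n).-1.+1)) :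
  x \in (if t is TypeB then [seq emx F t n (Pos i) Zero - emx F t n Zero (Neg i)
                               | i <- [:: 1%N; 2%N]] else [::]) <->
  t = TypeB /\ exists2 i, (0 < i < 3)%N & x = emx F t n (Pos i) Zero - emx F t n Zero (Neg i).
Proof.
case: t x => x; last by split=> // -[].
rewrite /= !inE; split=> [/orP[]/eqP->|[_ [[|[|[|i]]]//= _ ->]]]; rewrite ?eqxx ?orbT //.
  by split=> //; exists 1%N.
by split=> //; exists 2%N.
Qed.

(** Compares the d terms of [mexp] with the five of [sum_wedges_exp], where d may be on either side
    of 5. *)
Lemma eq_big_ord_tail0 (U : nmodType) (g : nat -> U) n m :
    (forall k, (minn n m <= k)%N -> g k = 0) ->
  \sum_(k < n) g k = \sum_(k < m) g k.
Proof.
move=> g0.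
suff E p : (minn n m <= p)%N -> \sum_(k < p) g k = \sum_(k < minn n m) g k.
  by rewrite (E n) ?geq_minl // (E m) ?geq_minr.
move=> np; rewrite -!(big_mkord xpredT g) (big_cat_nat (leq0n _) np) //=.
by rewrite [X in _ + X]big_nat [X in _ + X]big1 ?addr0 // => k /andP[/g0].
Qed.

Section LieAlgebra.
Variables (F : finFieldType) (t : rtype) (n : nat).
Hypothesis n_ge2 : (2 <= n)%N.
Local Notation d := (vdim t n).
Local Notation N := d.-1.
Local Notation V := 'cV[F]_N.+1.
Local Notation M := 'M[F]_N.+1.

(** Positions are zero-based: e_1 is [bvec 0] and e_(-1) is [bvec N], and the form pairs position i
    with N - i. *)
Definition bvec (i : nat) : V := delta_mx (inord i) 0.

Lemma vdim_ge4 : (4 <= d)%N.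
Proof. by case: t => /=; rewrite -addnn; lia. Qed.

Lemma vdimE : N.+1 = d.
Proof. by have := vdim_ge4; lia. Qed.

Lemma rev_inord i : (i <= N)%N -> rev_ord (inord i : 'I_N.+1) = inord (N - i).
Proof. by move=> iN; apply: val_inj; rewrite /= !inordK ?ltnS ?leq_subr // subSS. Qed.

Lemma bf_bvec i (x : V) : (i <= N)%N -> bf (bvec i) x = x (inord (N - i)) 0.
Proof. by move=> iN; rewrite bf_deltal rev_inord. Qed.

Lemma bf_bvec2 i j : (i <= N)%N -> (j <= N)%N -> bf (bvec i) (bvec j) = (i + j == N)%:R.
Proof.
move=> iN jN; rewrite bf_bvec // mxE eqxx andbT -val_eqE /= !inordK ?ltnS ?leq_subr //.
by congr (nat_of_bool _)%:R; apply/eqP/eqP; lia.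
Qed.

(** Here [a'] and [b'] stand for the opposite indices of [a] and [b], whose positions are the
    reflected ones. *)
Lemma emx_wedge a b i j : (i <= N)%N -> (j <= N)%N ->
    pos t n a = i -> pos t n b = (N - j)%N -> forall a' b',
    pos t n b' = j -> pos t n a' = (N - i)%N ->
  emx F t n a b - emx F t n b' a' = wedge (bvec i) (bvec j).
Proof.
move=> iN jN pa pb a' b' pb' pa'; rewrite /emx pa pb pb' pa'.
have E x y : (x <= N)%N -> (y <= N)%N ->
    bvec x *m sharp (bvec y) = delta_mx (inord x) (inord (N - y)) :> M.
  move=> xN yN; have -> : sharp (bvec y) = delta_mx 0 (inord (N - y)).
    apply/rowP=> k; rewrite !mxE eqxx andbT andTb -rev_inord //.
    by rewrite (can2_eq rev_ordK rev_ordK).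
  by rewrite mul_delta_mx.
by rewrite /wedge !E.
Qed.

(** With k.+1 the column, i < n corresponds to the root eps_(k+1) + eps_(i+1), the middle position i
    = n in type B to the short root eps_(k+1), and the larger i to eps_(k+1) - eps_(d-i). *)
Lemma mem_rootvecs (x : M) :
  x \in hei2_rootvecs F t n <->
  exists k i, [/\ (k < 2)%N, (k < i)%N, (i + k < N)%N & x = wedge (bvec k) (bvec i)].
Proof.
have mn : minn 2 n = 2 by lia.
have dE := vdimE.
have dn : (n.*2 <= d)%N by case: (t) => /=; lia.
rewrite -addnn in dn; split.
- rewrite /hei2_rootvecs mn !mem_cat => /or3P[].
  + case/or3P=> [/mapP[j]|/mapP[j]|//]; rewrite mem_iota => Hj ->.
      exists 0%N, (N - j.-1)%N; split; try lia.
      by apply: emx_wedge; try lia; move: dE; case: (t) => /=; rewrite -?addnn; lia.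
    exists 1%N, (N - j.-1)%N; split; try lia.
    by apply: emx_wedge; try lia; move: dE; case: (t) => /=; rewrite -?addnn; lia.
  + case/or3P=> [/mapP[j]|/mapP[j]|//]; rewrite mem_iota => Hj ->.
      exists 0%N, j.-1; split; try lia.
      by apply: emx_wedge; try lia; move: dE; case: (t) => /=; rewrite -?addnn; lia.
    exists 1%N, j.-1; split; try lia.
    by apply: emx_wedge; try lia; move: dE; case: (t) => /=; rewrite -?addnn; lia.
  + case/mem_short_rootvecs=> Et [i Hi ->].
    have dB : d = (n + n).+1 by rewrite Et /= -addnn.
    exists i.-1, n; split; try lia.
    by apply: emx_wedge; try lia; rewrite Et /= -?addnn; lia.
case=> k [i [k2 ki ik ->]]; rewrite /hei2_rootvecs mn !mem_cat.
have Ek : k = 0 \/ k = 1%N by lia.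
have [lt_in|le_ni] := ltnP i n.
{ apply/or3P/Or32.
  rewrite -(@emx_wedge (Pos k.+1) (Neg i.+1) k i _ _ _ _ (Neg k.+1) (Pos i.+1)); try lia.
  - apply/or3P; case: Ek => Ek; rewrite Ek; [apply/Or31|apply/Or32];
      by apply/mapP; exists i.+1; rewrite ?mem_iota //; lia.
  all: by move: dE; case: (t) => /=; rewrite -?addnn; lia. }
have [[Et Ei]|le_d] : (t = TypeB /\ i = n) \/ (d <= i + n)%N.
  by case: (t) => /=; rewrite -?addnn; [have [->|?] := eqVneq i n; [left|right; lia]|right; lia].
- apply/or3P/Or33/mem_short_rootvecs; split=> //; exists k.+1; first lia.
  have dB : d = (n + n).+1 by rewrite Et /= -addnn.
  by rewrite -(@emx_wedge (Pos k.+1) Zero k i _ _ _ _ (Neg k.+1) Zero) ?Ei //; try lia;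
    rewrite Et /= -?addnn; lia.
- apply/or3P/Or31.
  rewrite -(@emx_wedge (Pos k.+1) (Pos (d - i)) k i _ _ _ _ (Neg k.+1) (Neg (d - i)));
    try lia.
  + apply/or3P; case: Ek => Ek; rewrite Ek; [apply/Or31|apply/Or32];
      by apply/mapP; exists (d - i)%N; rewrite ?mem_iota //; lia.
  all: by move: dE ik le_d le_ni; case: (t) => /=; rewrite -?addnn; lia.
Qed.

Local Notation rootspan := <<hei2_rootvecs F t n>>%VS.

Lemma mem_lie_span x : (x \in hei2_lie F t n) = (x \in rootspan).
Proof.
apply/imsetP/idP => [[c _ ->]|/(coord_span (X := in_tuple _)) ->].
  by apply: rpred_sum => k _; rewrite rpredZ ?memv_span ?mem_nth.
exists [ffun k => coord (in_tuple (hei2_rootvecs F t n)) k x] => //.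
by apply: eq_bigr => k _; rewrite ffunE.
Qed.

(** The condition on x leaves only the positions k < i < N - k allowed by [mem_rootvecs]. *)
Lemma wedge_in_span k (x : V) : (k < 2)%N ->
    (forall i : 'I_N.+1, (i <= k)%N || (N - k <= i)%N -> x i 0 = 0) ->
  wedge (bvec k) x \in rootspan.
Proof.
move=> k2 x0; rewrite [x]matrix_sum_delta.
rewrite (big_morph (wedge (bvec k)) (wedgeDr _) (wedge0r _)).
apply: rpred_sum => i _; rewrite big_ord1 wedgeZr.
have [ik|] := boolP ((i <= k)%N || (N - k <= i)%N).
  by rewrite x0 // scale0r rpred0.
rewrite negb_or -!ltnNge => /andP[ki iN]; apply: rpredZ; apply: memv_span.
apply/mem_rootvecs; exists k, i; split=> //; first lia.
by rewrite /bvec inord_val.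
Qed.

Local Notation e := (bvec 0).
Local Notation f := (bvec 1).
Local Notation e' := (bvec N).
Local Notation f' := (bvec N.-1).
Local Notation W1 := (W1 e e').
Local Notation W := (W e f e' f').

Let N_ge3 : (3 <= N)%N. Proof. by have := vdim_ge4; lia. Qed.

Let ee : bf e e = 0. Proof. by rewrite bf_bvec2 //; case: eqP => //; lia. Qed.
Let ef : bf e f = 0. Proof. by rewrite bf_bvec2 //; try lia; case: eqP => //; lia. Qed.
Let ff : bf f f = 0. Proof. by rewrite bf_bvec2 //; try lia; case: eqP => //; lia. Qed.
Let ee' : bf e e' = 1. Proof. by rewrite bf_bvec2 //; case: eqP => //; lia. Qed.
Let ef' : bf e f' = 0. Proof. by rewrite bf_bvec2 //; try lia; case: eqP => //; lia. Qed.
Let fe' : bf f e' = 0. Proof. by rewrite bf_bvec2 //; try lia; case: eqP => //; lia. Qed.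
Let ff' : bf f f' = 1. Proof. by rewrite bf_bvec2 //; try lia; case: eqP => //; lia. Qed.
Let e'e' : bf e' e' = 0. Proof. by rewrite bf_bvec2 //; try lia; case: eqP => //; lia. Qed.
Let e'f' : bf e' f' = 0. Proof. by rewrite bf_bvec2 //; try lia; case: eqP => //; lia. Qed.
Let f'f' : bf f' f' = 0. Proof. by rewrite bf_bvec2 //; try lia; case: eqP => //; lia. Qed.

Lemma mem_lie x : x \in hei2_lie F t n <->
  exists w v, [/\ w \in W1, v \in W & x = wedge e w + wedge f v].
Proof.
split.
  case/imsetP=> c _ ->; elim/big_ind: _ => [|x1 x2|k _].
  - by exists 0, 0; rewrite W1_0 W_0 !wedge0r addr0.
  - move=> [w [v [ww vv ->]]] [w' [v' [ww' vv' ->]]].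
    by exists (w + w'), (v + v'); rewrite W1D ?WD // !wedgeDr addrACA.
  have /mem_rootvecs[j [i [j2 ji ijN ->]]] := mem_nth 0 (ltn_ord k).
  have [j0|j1] : j = 0 \/ j = 1%N by lia.
    exists (c k *: bvec i), 0; split; rewrite ?W_0 ?wedge0r ?addr0 ?wedgeZr ?j0 //.
    apply/W1P; rewrite !bfZr !bf_bvec2; try lia.
    by split; case: eqP; rewrite ?mulr0 //; lia.
  exists 0, (c k *: bvec i); split; rewrite ?W1_0 ?wedge0r ?add0r ?wedgeZr ?j1 //.
  apply/WP; rewrite !bfZr !bf_bvec2; try lia.
  by split; case: eqP; rewrite ?mulr0 //; lia.
(* Orthogonality to e', e, f, f' is the vanishing of the coordinates at 0, N, N - 1, 1. *)
have c0 (y : V) : bf e' y = y (inord 0) 0 by rewrite bf_bvec // subnn.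
have cN (y : V) : bf e y = y (inord N) 0 by rewrite bf_bvec // subn0.
have cN1 (y : V) : bf f y = y (inord N.-1) 0 by rewrite bf_bvec ?subn1 //; lia.
have c1 (y : V) : bf f' y = y (inord 1) 0.
  by rewrite bf_bvec ?leq_pred //; congr (y (inord _) 0); lia.
move=> [w [v [/W1P[ew e'w] /WP[ev e'v fv f'v] ->]]].
rewrite mem_lie_span; apply: rpredD; apply: wedge_in_span => // i Hi.
  have [Ei|Ei] : (i = 0 :> nat) \/ (i = N :> nat) by have := ltn_ord i; lia.
    by rewrite -[i]inord_val Ei -c0.
  by rewrite -[i]inord_val Ei -cN.
have [E|[E|[E|E]]] :
    (i = 0 :> nat) \/ (i = N :> nat) \/ (i = 1%N :> nat) \/ (i = N.-1 :> nat).
  by have := ltn_ord i; lia.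
- by rewrite -[i]inord_val E -c0.
- by rewrite -[i]inord_val E -cN.
- by rewrite -[i]inord_val E -c1.
- by rewrite -[i]inord_val E -cN1.
Qed.

Lemma card_frame_orth : #|W| = (#|F| ^ (d - 4))%N.
Proof.
have q_gt0 : (0 < #|F|)%N by apply/card_gt0P; exists 0.
apply/eqP; rewrite -(eqn_pmul2l (_ : 0 < #|F| ^ 4)%N) ?expn_gt0 ?q_gt0 //.
rewrite -(@card_space F N e f e' f') // card_mx muln1 -expnD.
by rewrite subnKC ?vdim_ge4 // vdimE.
Qed.

(** * The exponential of the Lie algebra and its characters *)

Section Exp.
Hypotheses (n2 : 2%:R != 0 :> F) (n3 : 3%:R != 0 :> F).

Lemma mexp_wedges (w v : V) : w \in W1 -> v \in W ->
  mexp (wedge e w + wedge f v) =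
    siegel e (w + (2%:R)^-1 *: (wedge f v *m w)
                + (6%:R)^-1 *: (wedge f v *m (wedge f v *m w)))
      *m siegel f v.
Proof.
move=> ww vv; have [/W1P[ew _] /WP[ev _ fv _]] := (ww, vv).
rewrite -sum_wedges_exp //.
apply: (eq_big_ord_tail0 (g := fun k => (k`!%:R)^-1 *: (wedge e w + wedge f v) ^+ k)) => k.
rewrite geq_min => Hk.
have Z5 := wedges_exp5 ee ff ef ew fv ev.
have [k5|k5] := leqP 5 k; first by rewrite -(subnK k5) exprD Z5 mulr0 scaler0.
(* The only term left is k = 4 with d = 4; then W has one element, so v = 0. *)
have [d4 k4] : d = 4 /\ k = 4 by have := vdim_ge4; have := vdimE; lia.
rewrite k4 (wedges_exp4 ee ff ef ew fv ev) ?scaler0 //.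
have W_le1 : (#|W| <= 1)%N by rewrite card_frame_orth d4.
exact: (card_le1_eqP W_le1) 0 v (W_0 _ _ _ _) vv.
Qed.

Lemma wedge_W1 (v w : V) : v \in W -> w \in W1 -> wedge f v *m w \in W1.
Proof.
move=> /WP[ev e'v _ _] _; apply/W1P; rewrite mul_wedge !bfE ef (bfC e' f) fe' ev e'v.
by split; ring.
Qed.

Lemma wedge_cubed (v w : V) : v \in W -> wedge f v *m (wedge f v *m (wedge f v *m w)) = 0.
Proof.
move=> /WP[_ _ fv _]; rewrite !mul_wedge !bfE ff fv (bfC v f) fv.
by apply/colP=> i; rewrite !mxE; ring.
Qed.

(** With Y = wedge f v, the map 1 + Y/2 + Y^2/6 of [mexp_wedges] is invertible on W1 since Y^3 = 0,
    so the exponentials are exactly the products S_e(w) S_f(v), which already form a group. *)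
Lemma Hei2_setE : Hei2_set F t n = hset e f (setX W1 W).
Proof.
have n6 : 6%:R != 0 :> F by rewrite -[6%N]/(2 * 3)%N natrM mulf_neq0.
have n12 : 12%:R != 0 :> F by rewrite -[12%N]/(2 * 6)%N natrM mulf_neq0.
have W1Z c w : w \in W1 -> c *: w \in W1.
  by move=> /W1P[a b]; apply/W1P; rewrite !bfZr a b !mulr0.
apply/setP=> g; rewrite inE; apply/existsP/hsetP.
  case=> x /andP[/mem_lie[w [v [ww vv ->]]] /eqP]; rewrite mexp_wedges // => E.
  exists (w + (2%:R)^-1 *: (wedge f v *m w)
            + (6%:R)^-1 *: (wedge f v *m (wedge f v *m w))), v.
  have inW : w + (2%:R)^-1 *: (wedge f v *m w)
      + (6%:R)^-1 *: (wedge f v *m (wedge f v *m w)) \in W1.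
    by rewrite !W1D ?W1Z ?wedge_W1.
  by split; [apply/setXP|apply: val_inj; rewrite (val_hs ee ff n2 inW vv)].
case=> w [v [/setXP[ww vv] ->]].
(* inverse of the substitution in [mexp_wedges]: 1/12 = 1/4 - 1/6 *)
set w0 := w - (2%:R)^-1 *: (wedge f v *m w)
            + (12%:R)^-1 *: (wedge f v *m (wedge f v *m w)).
have w0W : w0 \in W1 by rewrite !W1D ?W1N ?W1Z ?wedge_W1.
exists (wedge e w0 + wedge f v); apply/andP; split.
  by apply/mem_lie; exists w0, v.
rewrite mexp_wedges //; apply/eqP; rewrite [LHS](val_hs ee ff n2 ww vv); congr (siegel _ _ *m _).
have Y0 : wedge f v *m w0 =
    wedge f v *m w - (2%:R)^-1 *: (wedge f v *m (wedge f v *m w)).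
  by rewrite /w0 mulmxDr mulmxBr -!scalemxAr wedge_cubed // scaler0 addr0.
have Y1 : wedge f v *m (wedge f v *m w0) = wedge f v *m (wedge f v *m w).
  by rewrite Y0 mulmxBr -!scalemxAr wedge_cubed // scaler0 subr0.
rewrite Y1 Y0 /w0; apply/colP=> i; rewrite !mxE.
by field; rewrite n2 n6 n12.
Qed.

Lemma card_irr_Hei2 k :
  #|[set i : Iirr (Hei2 F t n) | 'chi_i 1%g == (#|F| ^ k)%N%:R]|
    = ((k == d - 4) * (#|F| * #|F|.-1)
       + (k == 1) * (#|F| ^ (d - 4).-1 * (#|F| ^ (d - 4)).-1)
       + (k == 0) * #|F| ^ (d - 4).+1)%N.
Proof.
have q_gt1 : (1 < #|F|)%N.
  by apply/card_gt1P; exists 0, 1; rewrite ?inE // eq_sym oner_neq0.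
have [G defG] : exists G : {group {unit M}}, G :=: hset e f (setX W1 W).
  apply: (ex_hset ee ef ff fe' n2) => //; first by apply/setXP; rewrite W1_0 W_0.
  move=> w v w' v' /setXP[a b] /setXP[a' b']; apply/setXP.
  by rewrite W1D ?WD ?(siegel_W1 ef fe' b a').
have defH : Hei2 F t n :=: hset e f (setX W1 W).
  by rewrite /= Hei2_setE -defG genGid.
rewrite (card_irr_hset ee ef ff ee' ef' fe' ff' e'e' e'f' f'f' n2 defH card_frame_orth).
have k1 : (#|F| ^ k == #|F|)%N = (k == 1%N) by rewrite -[X in _ == X]expn1 eqn_exp2l.
have k0 : (#|F| ^ k == 1)%N = (k == 0) by rewrite -[X in _ == X](expn0 #|F|) eqn_exp2l.
by rewrite eqn_exp2l // k1 k0.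
Qed.
End Exp.

End LieAlgebra.

(** * The counts as polynomials in q - 1 *)

Theorem theorem5p2 (t : rtype) (n : nat) (hn : (2 <= n)%N) (e : nat) :
  exists P : seq nat,
    forall F : finFieldType,
      (forall p : nat, p \in [pchar F] -> (3 < p)%N) ->
      #|[set i : Iirr (Hei2 F t n) | 'chi_i 1%g == ((#|F| ^ e)%N)%:R]|
        = (\sum_(k < size P) nth 0 P k * (#|F|.-1) ^ k)%N.
Proof.
pose m := (vdim t n - 4)%N; pose Q : {poly nat} := 'X + 1.
(* With X standing for q - 1 and Q for q, the factor q^m - 1 is written as X times a geometric sum,
   so that all coefficients are natural numbers. *)
pose P : {poly nat} := (e == m)%:R * (Q * 'X)
  + (e == 1)%:R * (Q ^+ m.-1 * ('X * \sum_(i < m) Q ^+ i)) + (e == 0)%:R * Q ^+ m.+1.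
exists P => F hF.
have ndvd (p : nat) : prime p -> (p <= 3)%N -> p%:R != 0 :> F.
  move=> pr_p p3; apply/negP => p0.
  by have := hF p; rewrite inE pr_p p0 => /(_ isT); rewrite ltnNge p3.
have q_gt0 : (0 < #|F|)%N by apply/card_gt0P; exists 0.
rewrite card_irr_Hei2 ?ndvd // -/m.
have q1 : #|F|.-1 + 1 = #|F| by rewrite natrDE addn1 prednK.
have QE : Q.[#|F|.-1] = #|F| by rewrite !hornerE.
transitivity P.[#|F|.-1]; last first.
  by rewrite horner_coef; apply: eq_bigr => k _; rewrite natrXE.
rewrite /P !(hornerD, hornerM, horner_exp, horner_sum, hornerX, hornerMn, hornerC) q1.
under eq_bigr => i _ do rewrite horner_exp QE natrXE.
by rewrite predn_exp !ssralg.natrE.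
Qed.
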